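(* Let $K\subseteq\mathbb{R}^n$ be a convex body and let $\Lambda\subseteq\mathbb{R}^n$ be an $n$-dimensional lattice. (i) For $1\le i\le n-1$, we have $$\mu_{i+1}(K,\Lambda)\le\mu_i(K,\Lambda)+\rho_{i+1}(K,\Lambda).$$ (ii) For $1\le i\le n$, we have $$\max_{1\le j\le i}\rho_j(K,\Lambda)\le\mu_i(K,\Lambda)\le\sum_{j=1}^i\rho_j(K,\Lambda).$$
   Context: A convex body in $\mathbb{R}^n$ is a compact convex set with non-empty interior. An $n$-dimensional lattice is a set $\Lambda=B\mathbb{Z}^n$ with $B\in\mathbb{R}^{n\times n}$ invertible. $K_c=K-K=\{x-y:x,y\in K\}$ is the difference body. Covering minima: for $1\le i\le n$, $\mu_i(K,\Lambda)=\inf\{\mu>0:\Lambda+\mu K+L=\mathbb{R}^n\text{ for all }(n-i)\text{-dimensional linear subspaces }L\subseteq\mathbb{R}^n\}$. Equivalently, with the covering radius $\mu(K,\Lambda)=\min\{\mu>0:\Lambda+\mu K=\mathbb{R}^n\}$, one has $\mu_i(K,\Lambda)=\max\mu(K|L^\perp,\Lambda|L^\perp)$ over the $(n-i)$-dimensional linear lattice planes $L$ of $\Lambda$ (linear subspaces $L$ with $\dim L=\dim(L\cap\Lambda)=n-i$), where $\cdot|L^\perp$ is orthogonal projection onto $L^\perp$. Packing minima: for $1\le i\le n$, $\rho_i(K,\Lambda)=\inf\{\rho>0:(\rho K_c+L)\cap\Lambda\neq L\cap\Lambda\text{ for all }(n-i)\text{-dimensional linear subspaces }L\subseteq\mathbb{R}^n\}$.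 Equivalently, $\rho_i(K,\Lambda)=\max\lambda_1(K_c|L^\perp,\Lambda|L^\perp)$ over the $(n-i)$-dimensional linear lattice planes $L$ of $\Lambda$, where, for an origin-symmetric convex body $M$ and a lattice $\Gamma$ in the same Euclidean space, $\lambda_1(M,\Gamma)=\min\{\lambda>0:\lambda M\cap\Gamma\ne\{0\}\}$. *)

(* Defs.v *)
From mathcomp Require Import all_boot all_order all_algebra.
From mathcomp Require Import all_classical all_reals all_analysis.
Import Order.TTheory GRing.Theory Num.Theory.
Import numFieldNormedType.Exports.

Set Implicit Arguments.
Unset Strict Implicit.
Unset Printing Implicit Defensive.

Local Open Scope classical_set_scope.
Local Open Scope ring_scope.

Definition minkowski_sum (V : zmodType) (A B : set V) : set V :=
  [set x + y | x in A & y in B].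

Definition dilate (R : pzRingType) (V : lmodType R) (r : R) (A : set V) : set V :=
  [set r *: x | x in A].

Definition difference_body (V : zmodType) (K : set V) : set V :=
  [set x - y | x in K & y in K].

Definition convex_body (R : realType) (n : nat) (K : set 'cV[R]_n) : Prop :=
  [/\ compact K, convex_set (K : set (convex_lmodType 'cV[R]_n))
    & interior K !=set0].

Definition is_lattice (R : realType) (n : nat) (Lam : set 'cV[R]_n) : Prop :=
  exists2 B : 'M[R]_n, B \in unitmx
    & Lam = [set B *m map_mx intr z | z in [set: 'cV[int]_n]].

(* The library's [inf] is 0 on a set that is empty or not bounded below. In
   both definitions below the set is bounded below by 0, and it is nonempty
   when K is a convex body, Lam a lattice and 1 <= i <= n. *)

Definition covering_minimum (R : realType) (n : nat) (i : nat)
    (K Lam : set 'cV[R]_n) : R :=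
  inf [set mu : R | 0 < mu /\
    forall L : {vspace 'cV[R]_n}, \dim L = (n - i)%N ->
      minkowski_sum (minkowski_sum Lam (dilate mu K)) [set` L] = setT].

Definition packing_minimum (R : realType) (n : nat) (i : nat)
    (K Lam : set 'cV[R]_n) : R :=
  inf [set rho : R | 0 < rho /\
    forall L : {vspace 'cV[R]_n}, \dim L = (n - i)%N ->
      minkowski_sum (dilate rho (difference_body K)) [set` L] `&` Lam
        <> [set` L] `&` Lam].

(* Main.v *)
(* For (i), let dim L = n - i - 1 and let v be a lattice vector outside L with
   v in rho K_c + L. The subspace L + <v> has dimension n - i, so
   Lam + mu K + L + <v> is everything; reducing the coefficient of v modulo 1
   leaves the segment [0, v], which a translate of rho K absorbs modulo L. The
   same argument with mu = 0 gives mu_1 <= rho_1, and the upper bound in (ii)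
   follows by induction. For the lower bound, if Lam + mu K + L is everything
   and L is proper, then a point just outside mu K + L lies in l + mu K + L for
   a lattice vector l outside L, so that l is in (mu + eps) K_c + L; moreover
   mu_j is nondecreasing in j, because enlarging L preserves coverings. All of
   this works for arbitrary subspaces L, so lattice planes never enter. *)

Require Import Defs.
From mathcomp Require Import all_boot all_order all_algebra.
From mathcomp Require Import all_classical all_reals all_analysis.
From mathcomp Require Import ring lra.
Import Order.TTheory GRing.Theory Num.Theory.
Import numFieldNormedType.Exports.
Set Implicit Arguments.
Unset Strict Implicit.
Unset Printing Implicit Defensive.
Local Open Scope classical_set_scope.
Local Open Scope ring_scope.

(** * Subspaces, bounds for linear maps, rounding *)

Lemma dimv_add_line (K : fieldType) (V : vectType K) (L : {vspace V}) (v : V) :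
  v \notin L -> \dim (L + <[v]>) = (\dim L).+1.
Proof.
move=> vL; rewrite dimv_disjoint_sum ?dim_vline.
  by case: eqVneq vL => [->|]; rewrite ?mem0v //= addn1.
apply/eqP; rewrite -subv0; apply/subvP => x; rewrite memv_cap.
case/andP=> xL /vlineP[t xE]; move: xL; rewrite xE memv0.
by rewrite rpredZeq (negPf vL) orbF => /eqP ->; rewrite scale0r.
Qed.

Lemma exists_subspace (K : fieldType) (V : vectType K) (L : {vspace V})
    (m : nat) : (m <= \dim L)%N -> exists2 U : {vspace V}, (U <= L)%VS & \dim U = m.
Proof.
move=> mL; exists <<take m (vbasis L)>>%VS.
  by apply/span_subvP => x /mem_take; apply: vbasis_mem.
have fr : free (take m (vbasis L)).
  apply: (@catl_free _ _ (drop m (vbasis L))); rewrite cat_take_drop.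
  exact: basis_free (vbasisP L).
by rewrite (eqnP fr) size_takel // size_tuple.
Qed.

Lemma linear_norm_le (R : realType) (n : nat) (V : normedModType R)
    (f : {linear 'cV[R]_n -> V}) :
  exists2 C : R, 0 <= C & forall x, `|f x| <= C * `|x|.
Proof.
exists (\sum_(i < n) `|f (delta_mx i 0)|) => [|x]; first exact: sumr_ge0.
have -> : f x = \sum_(i < n) x i 0 *: f (delta_mx i 0).
  rewrite [in LHS](matrix_sum_delta x) linear_sum; apply: eq_bigr => i _.
  by rewrite big_ord1 linearZ.
rewrite mulr_suml (le_trans (ler_norm_sum _ _ _)) // ler_sum // => i _.
rewrite normrZ mulrC ler_wpM2l //.
rewrite [leRHS]mx_normrE.
exact: (@le_bigmax_cond _ _ _ _ (i, 0) xpredT (fun ij => `|x ij.1 ij.2|)).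
Qed.

Lemma norm_sub_floor_le1 (R : realType) (m n : nat) (A : 'M[R]_(m, n)) :
  `|A - map_mx intr (map_mx Num.floor A)| <= 1.
Proof.
rewrite [leLHS]mx_normrE; apply: bigmax_le => // -[i j] _ /=; rewrite !mxE.
by have /andP[] := floor_itv (A i j); rewrite intrD => *; rewrite ger0_norm; lra.
Qed.

(** * Convex bodies: combinations, inner balls, boundedness *)

Section ConvexBody.
Context (R : realType) (n : nat) (K : set 'cV[R]_n) (hK : convex_body K).

(** This merges two dilates: [s K + t K] lies in [(s + t) K]. If [s + t = 0], both scalars vanish
    and any point serves. *)
Lemma convex_body_comb (s t : R) (x y : 'cV[R]_n) :
  0 <= s -> 0 <= t -> K x -> K y ->
  exists2 z, K z & s *: x + t *: y = (s + t) *: z.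
Proof.
move=> s0 t0 Kx Ky; have [_ cK _] := hK.
have [st0|st0] := eqVneq (s + t) 0.
  exists x => //; have [-> ->] : s = 0 /\ t = 0 by split; lra.
  by rewrite addr0 !scale0r addr0.
have stp : 0 < s + t by rewrite lt_def st0 addr_ge0.
have p0 : 0 <= s / (s + t) by rewrite divr_ge0 // ltW.
have p1 : s / (s + t) <= 1 by rewrite ler_pdivrMr // mul1r lerDl.
exists ((s / (s + t)) *: x + (t / (s + t)) *: y); last first.
  by rewrite scalerDr !scalerA !(mulrC (s + t)) !divfK.
have <- : 1 - s / (s + t) = t / (s + t) by field.
by have := cK x y (Itv01 p0 p1); rewrite !inE; apply.
Qed.

Lemma convex_body_ball :
  exists a : 'cV[R]_n, exists2 d : R, 0 < d & forall w, `|w| < d -> K (a + w).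
Proof.
have [_ _ [a]] := hK; rewrite /interior /= => /nbhs_normP[d /= d0 dK].
exists a, d => // w wd; apply: dK => /=.
by rewrite opprD addNKr normrN.
Qed.

Lemma convex_body_bounded : exists2 C : R, 0 <= C & forall x, K x -> `|x| <= C.
Proof.
have [cK _ _] := hK; have [M [_ MK]] := compact_bounded cK.
exists (`|M| + 1) => [|x Kx]; first by rewrite addr_ge0.
by apply: MK Kx; have := ler_norm M; lra.
Qed.

End ConvexBody.

(** * Coverings and packings modulo a subspace *)

Section Covering.
Context (R : realType) (n : nat).
Implicit Types (K Lam : set 'cV[R]_n) (L : {vspace 'cV[R]_n}).

Definition covers Lam K (mu : R) L : Prop :=
  forall x, exists l k, [/\ Lam l, K k & x - l - mu *: k \in L].

Definition packs Lam K (rho : R) L : Prop :=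
  exists v a b, [/\ Lam v, K a, K b, v \notin L & v - rho *: (a - b) \in L].

Lemma coversP Lam K mu L :
  minkowski_sum (minkowski_sum Lam (dilate mu K)) [set` L] = setT <->
  covers Lam K mu L.
Proof.
split=> [cov x|cov].
  have : [set: 'cV[R]_n] x by [].
  rewrite -cov => -[_ [l Ll [_ [k Kk <-] <-]] [w Lw <-]].
  exists l, k; split=> //.
  suff -> : l + mu *: k + w - l - mu *: k = w by [].
  by rewrite -(addrA _ (- l)) -opprD addrAC subrr add0r.
apply/seteqP; split=> // x _; have [l [k [Ll Kk Lw]]] := cov x.
exists (l + mu *: k); first by exists l => //; exists (mu *: k) => //; exists k.
by exists (x - l - mu *: k) => //; rewrite -(addrA x) -opprD subrKC.
Qed.

(** As [0] lies in the difference body, the left-hand set always contains the right-hand one; they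
    differ only through a lattice vector outside [L]. *)
Lemma packsP Lam K rho L : K !=set0 ->
  minkowski_sum (dilate rho (difference_body K)) [set` L] `&` Lam
    <> [set` L] `&` Lam <-> packs Lam K rho L.
Proof.
move=> [k0 Kk0]; split=> [ne|[v [a [b [Lv Ka Kb vL vabL]]]] e].
  apply: contrapT => np; apply: ne; apply/seteqP; split=> x /= [xS Lx]; split=> //.
    apply: contrapT => xL; apply: np.
    case: xS => _ [_ [a Ka [b Kb <-]] <-] [w Lw xE].
    exists x, a, b; split=> //; first exact/negP.
    by rewrite -xE addrAC subrr add0r.
  exists 0; last by exists x => //; rewrite add0r.
  exists 0; last by rewrite scaler0.
  by exists k0 => //; exists k0 => //; rewrite subrr.
suff : ([set` L] `&` Lam) v by move=> [/= vL' _]; rewrite vL' in vL.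
rewrite -e; split=> //; exists (rho *: (a - b)).
  by exists (a - b) => //; exists a => //; exists b.
by exists (v - rho *: (a - b)) => //; rewrite addrC subrK.
Qed.

Lemma covers_supspace Lam K mu (U L : {vspace 'cV[R]_n}) :
  (U <= L)%VS -> covers Lam K mu U -> covers Lam K mu L.
Proof.
move=> /subvP UL cov x; have [l [k [Ll Kk xU]]] := cov x.
by exists l, k; split=> //; apply: UL.
Qed.

Lemma lattice_addmulz Lam (x y : 'cV[R]_n) (m : int) :
  is_lattice Lam -> Lam x -> Lam y -> Lam (x + m%:~R *: y).
Proof.
move=> [B _ ->] [z1 _ <-] [z2 _ <-]; exists (z1 + m *: z2) => //.
rewrite map_mxD mulmxDr; congr (_ + _).
rewrite scalemxAr; congr (_ *m _); apply/matrixP => i j.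
by rewrite !mxE; exact: intrM.
Qed.

Lemma lattice0 Lam : is_lattice Lam -> Lam 0.
Proof. by move=> [B _ ->]; exists 0 => //; rewrite map_mx0 mulmx0. Qed.

Lemma covers_add_line Lam K mu rho L (v a b : 'cV[R]_n) :
  convex_body K -> is_lattice Lam -> 0 <= mu -> 0 <= rho ->
  Lam v -> K a -> K b -> v - rho *: (a - b) \in L ->
  covers Lam K mu (L + <[v]>) -> covers Lam K (mu + rho) L.
Proof.
move=> hK hL mu0 rho0 Lv Ka Kb vL cov x.
(* The shift by [rho *: b] makes the remainder fit: modulo [L], [rho *: b + s *: v] is [rho] times
   the point [s *: a + (1 - s) *: b] of [K]. *)
have [l [k [Ll Kk /memv_addP[w wL [_ /vlineP[t ->] xE]]]]] := cov (x - rho *: b).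
pose s := t - (Num.floor t)%:~R.
have /andP[ft tf] := floor_itv t.
have s0 : 0 <= s by rewrite /s; lra.
have s1 : 0 <= 1 - s by move: tf; rewrite intrD /s; lra.
have [c Kc cE] := convex_body_comb hK s0 s1 Ka Kb.
have [d Kd dE] := convex_body_comb hK mu0 rho0 Kk Kc.
exists (l + (Num.floor t)%:~R *: v), d; split=> //.
  exact: lattice_addmulz.
have -> : x - (l + (Num.floor t)%:~R *: v) - (mu + rho) *: d
    = w + s *: (v - rho *: (a - b)); last by rewrite memvD ?memvZ.
have {}cE : c = s *: a + (1 - s) *: b by rewrite cE subrKC scale1r.
rewrite -dE cE.
have -> : x = rho *: b + l + mu *: k + (w + t *: v).
  by rewrite -xE; apply/matrixP => i j; rewrite !mxE; ring.
by apply/matrixP => i j; rewrite !mxE /s; ring.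
Qed.

Lemma packs_of_covers Lam K mu eps L :
  convex_body K -> 0 < mu -> 0 < eps -> (\dim L < n)%N ->
  covers Lam K mu L -> packs Lam K (mu + eps) L.
Proof.
move=> hK mu0 eps0 Ln cov.
have [u uL] : exists u, u \notin L.
  have : ~~ (fullv <= L)%VS.
    by apply/negP => /dimvS; rewrite dimvf /dim /= muln1 leqNgt Ln.
  by case/subvPn => u _ uL; exists u.
have [a [d d0 aK]] := convex_body_ball hK.
have Ka : K a by rewrite -[a]addr0; apply: aK; rewrite normr0.
have [h h0 hu] : exists2 h, 0 < h & K (a + h *: u).
  have nu : 0 < `|u| + 1 by rewrite ltr_wpDl.
  exists (d / (`|u| + 1)); first by rewrite divr_gt0.
  apply: aK; rewrite normrZ gtr0_norm ?divr_gt0 // mulrAC ltr_pdivrMr //.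
  by rewrite ltr_pM2l // ltrDl.
(* A discrete walk from [mu *: a] finds the exit from [mu K + L]. Each increment is
   [eps *: (a + h *: u) - eps *: a], a point of [eps K_c]. *)
pose p k := mu *: a + (k%:R * (eps * h)) *: u.
pose P k := exists2 c, K c & p k - mu *: c \in L.
have P0 : P 0%N by exists a => //; rewrite /p mul0r scale0r addr0 subrr mem0v.
have [k Pk Pk1] : exists2 k, P k & ~ P k.+1.
  (* If the walk never left [mu K + L], it would stay bounded modulo [L], although [u] is outside
     [L]. *)
  apply: contrapT => np.
  have allP k : P k.
    elim: k => // k Pk; apply: contrapT => Pk1; apply: np; by exists k.
  (* [q] serves as the quotient map by [L]: it kills [L] but not [u]. *)
  pose q := (\1 - projv L)%VF : 'End('cV[R]_n).
  have qE x : q x = x - projv L x by rewrite /q add_lfunE opp_lfunE id_lfunE.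
  have qL x : x \in L -> q x = 0 by move=> xL; rewrite qE projv_id // subrr.
  have qu : 0 < `|q u|.
    rewrite normr_gt0 qE subr_eq0; apply: contra uL => /eqP ->.
    exact: memv_proj.
  have [C C0 CK] := convex_body_bounded hK.
  have [D D0 qD] := @linear_norm_le R n 'cV[R]_n q.
  (* [M] bounds [mu *: (q c - q a)] for [c] in [K], while each step moves the image under [q] by
     length [e]. *)
  pose M := mu * (D * C + D * C).
  pose e := eps * h * `|q u|.
  have e0 : 0 < e by rewrite !mulr_gt0.
  have [c Kc pc] := allP (Num.bound (M / e)).
  have M0 : 0 <= M by apply: mulr_ge0 (ltW mu0) _; rewrite addr_ge0 ?mulr_ge0.
  have := archi_boundP (divr_ge0 M0 (ltW e0)).
  rewrite ltr_pdivrMr // ltNge => /negP; apply.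
  set N := Num.bound _ in pc *.
  have qp : (N%:R * (eps * h)) *: q u = mu *: (q c - q a).
    have := qL _ pc; rewrite /p linearB linearD !linearZ /= => qpc.
    apply/eqP; rewrite -subr_eq0 -[X in _ == X]qpc scalerBr scalerN opprB.
    by rewrite addrA (addrC (_ *: q u)).
  have Ne : N%:R * e = `|(N%:R * (eps * h)) *: q u|.
    by rewrite normrZ ger0_norm ?mulr_ge0 ?(ltW eps0) ?(ltW h0) // /e !mulrA.
  apply: le_trans (_ : `|(N%:R * (eps * h)) *: q u| <= M); first by rewrite -Ne.
  rewrite qp normrZ gtr0_norm // ler_wpM2l ?(ltW mu0) //.
  apply: le_trans (ler_normB _ _) _; apply: lerD.
    by apply: le_trans (qD _) _; rewrite ler_wpM2l // CK.
  by apply: le_trans (qD _) _; rewrite ler_wpM2l // CK.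
have [c Kc pcL] := Pk.
have [l [c' [Ll Kc' plL]]] := cov (p k.+1).
(* Modulo [L], [l] is [mu *: (c - c')] plus one increment; [y] collects the positive terms and [z]
   the negative ones. *)
have [y Ky yE] := convex_body_comb hK (ltW mu0) (ltW eps0) Kc hu.
have [z Kz zE] := convex_body_comb hK (ltW mu0) (ltW eps0) Kc' Ka.
exists l, y, z; split=> //.
  apply/negP => lL; apply: Pk1; exists c' => //.
  have -> : p k.+1 - mu *: c' = (p k.+1 - l - mu *: c') + l.
    by apply/matrixP => i j; rewrite !mxE; ring.
  exact: memvD.
have -> : l - (mu + eps) *: (y - z)
    = (p k - mu *: c) - (p k.+1 - l - mu *: c'); last exact: memvB.
rewrite scalerBr -yE -zE /p.
by apply/matrixP => i j; rewrite !mxE -natr1; ring.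
Qed.

(** Rounding lattice coordinates down leaves an error of norm at most [C], and [mu K] contains an
    open ball of radius [mu * d = C + 1]. *)
Lemma exists_covers Lam K : convex_body K -> is_lattice Lam ->
  exists2 mu, 0 < mu & forall L, covers Lam K mu L.
Proof.
move=> hK [B Bu ->]; have [a [d d0 aK]] := convex_body_ball hK.
have [C C0 BC] := @linear_norm_le R n 'cV[R]_n (mulmx B).
exists ((C + 1) / d); first by rewrite divr_gt0 // ltr_wpDl.
set mu := _ / _ => L x.
have mu0 : 0 < mu by rewrite divr_gt0 // ltr_wpDl.
pose y := invmx B *m (x - mu *: a).
pose z := map_mx Num.floor y.
pose f := y - map_mx intr z.
exists (B *m map_mx intr z), (a + mu^-1 *: (B *m f)); split.
- by exists z.
- apply: aK; rewrite normrZ gtr0_norm ?invr_gt0 // mulrC ltr_pdivrMr //.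
  apply: (@le_lt_trans _ _ C); last by rewrite /mu mulrC divfK ?gt_eqF // ltrDl.
  apply: le_trans (BC _) _; rewrite -[leRHS]mulr1 ler_wpM2l //.
  exact: norm_sub_floor_le1.
- rewrite scalerDr scalerA divff ?gt_eqF // scale1r /f mulmxBr /y mulKVmx //.
  set r := B *m _; suff -> : x - r - (mu *: a + (x - mu *: a - r)) = 0.
    exact: mem0v.
  by apply/matrixP => i j; rewrite !mxE; ring.
Qed.

Lemma exists_packs Lam K : convex_body K -> is_lattice Lam ->
  exists2 rho, 0 < rho & forall L, (\dim L < n)%N -> packs Lam K rho L.
Proof.
move=> hK hL; have [mu mu0 cov] := exists_covers hK hL.
exists (mu + 1) => [|L Ln]; first by rewrite addr_gt0.
exact: packs_of_covers.
Qed.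

End Covering.

(** * Inequalities between the minima *)

Section Minima.
Context (R : realType) (n : nat) (K Lam : set 'cV[R]_n).
Context (hK : convex_body K) (hLam : is_lattice Lam).

Lemma convex_body_nonempty : K !=set0.
Proof. by have [_ _ [a /interior_subset]] := hK; exists a. Qed.

Lemma covering_minimum_le i mu : 0 < mu ->
  (forall L, \dim L = (n - i)%N -> covers Lam K mu L) ->
  covering_minimum i K Lam <= mu.
Proof.
move=> mu0 cov; apply: ge_inf; first by exists 0 => r [/ltW].
by split=> // L /cov /coversP.
Qed.

(** The infimum of an empty set is [0] by default, so a bound from below relies on
    [exists_covers]. *)
Lemma le_covering_minimum i x :
  (forall mu, 0 < mu -> (forall L, \dim L = (n - i)%N -> covers Lam K mu L) ->
     x <= mu) ->
  x <= covering_minimum i K Lam.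
Proof.
move=> h; apply: lb_le_inf => [|mu [mu0 cov]].
  have [mu mu0 cov] := exists_covers hK hLam.
  by exists mu; split=> // L _; apply/coversP.
by apply: h => // L /cov /coversP.
Qed.

Lemma packing_minimum_le i rho : 0 < rho ->
  (forall L, \dim L = (n - i)%N -> packs Lam K rho L) ->
  packing_minimum i K Lam <= rho.
Proof.
move=> rho0 pack; apply: ge_inf; first by exists 0 => r [/ltW].
by split=> // L /pack /(packsP _ _ _ convex_body_nonempty).
Qed.

Lemma le_packing_minimum i x : (0 < i <= n)%N ->
  (forall rho, 0 < rho -> (forall L, \dim L = (n - i)%N -> packs Lam K rho L) ->
     x <= rho) ->
  x <= packing_minimum i K Lam.
Proof.
move=> /andP[i0 ile] h; apply: lb_le_inf => [|rho [rho0 pack]].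
  have [rho rho0 pack] := exists_packs hK hLam.
  exists rho; split=> // L Ln; apply/(packsP _ _ _ convex_body_nonempty).
  (* [0 < i <= n] makes [L] proper, so that lattice vectors outside it exist. *)
  by apply: pack; rewrite Ln ltn_subrL i0 (leq_trans i0).
by apply: h => // L /pack /(packsP _ _ _ convex_body_nonempty).
Qed.

(** Here [mu = 0] is allowed, so that [i = 0] can start the induction. *)
Lemma covers_of_packs i mu rho (L : {vspace 'cV[R]_n}) :
  (i < n)%N -> 0 <= mu -> 0 <= rho ->
  (forall L', \dim L' = (n - i)%N -> covers Lam K mu L') ->
  \dim L = (n - i.+1)%N -> packs Lam K rho L -> covers Lam K (mu + rho) L.
Proof.
move=> ni mu0 rho0 cov dL [v [a [b [Lv Ka Kb vL vabL]]]].
apply: (@covers_add_line _ _ _ _ _ _ _ v a b) => //; apply: cov.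
by rewrite dimv_add_line // dL -subSn.
Qed.

Lemma covering_minimumS_le i : (0 < i < n)%N ->
  covering_minimum i.+1 K Lam
    <= covering_minimum i K Lam + packing_minimum i.+1 K Lam.
Proof.
(* Isolating each infimum in turn reduces the claim to admissible [rho] and [mu], without
   attainment. *)
move=> /andP[i0 ni]; rewrite -lerBlDl; apply: le_packing_minimum => // rho rho0 pack.
rewrite lerBlDl -lerBlDr; apply: le_covering_minimum => mu mu0 cov.
rewrite lerBlDr; apply: covering_minimum_le; first exact: addr_gt0.
move=> L dL; apply: (@covers_of_packs i) => //; try exact: ltW.
exact: pack.
Qed.

Lemma covering_minimum1_le : (0 < n)%N ->
  covering_minimum 1 K Lam <= packing_minimum 1 K Lam.
Proof.
move=> n0; apply: le_packing_minimum => // rho rho0 pack.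
apply: covering_minimum_le => // L dL; rewrite -[rho]add0r.
apply: (@covers_of_packs 0) => //; [exact: ltW | | exact: pack].
move=> L'; rewrite subn0 => dL' x.
have [a Ka] := convex_body_nonempty.
(* In codimension [0] the subspace is everything, so any choice covers. *)
exists 0, a; split=> //; first exact: lattice0.
suff -> : L' = fullv by rewrite memvf.
by apply/eqP; rewrite eqEdim subvf dimvf /dim /= muln1 dL'.
Qed.

Lemma packing_le_covering i j : (0 < j <= i)%N -> (i <= n)%N ->
  packing_minimum j K Lam <= covering_minimum i K Lam.
Proof.
move=> /andP[j0 ji] ni; apply: le_covering_minimum => mu mu0 cov.
apply/ler_addgt0Pr => eps eps0.
apply: packing_minimum_le => [|L dL]; first exact: addr_gt0.
apply: packs_of_covers => //.
  by rewrite dL ltn_subrL j0 (leq_trans j0 (leq_trans ji ni)).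
(* Since [j <= i], [L] contains a subspace of dimension [n - i], whose covering passes up to [L]. *)
have [|U UL dU] := @exists_subspace _ _ L (n - i); first by rewrite dL leq_sub2l.
by apply: covers_supspace UL _; apply: cov.
Qed.

End Minima.

Theorem proposition2p3 (R : realType) (n : nat) (K Lam : set 'cV[R]_n)
    (hK : convex_body K) (hLam : is_lattice Lam) :
  (forall i : nat, (1 <= i <= n - 1)%N ->
     covering_minimum i.+1 K Lam
       <= covering_minimum i K Lam + packing_minimum i.+1 K Lam)
  /\
  (forall i : nat, (1 <= i <= n)%N ->
     \big[Num.max/packing_minimum 1 K Lam]_(1 <= j < i.+1)
         packing_minimum j K Lam
       <= covering_minimum i K Lam
     /\ covering_minimum i K Lam
       <= \sum_(1 <= j < i.+1) packing_minimum j K Lam).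
Proof.
split=> [i /andP[i0 ni]|i /andP[i0 ni]].
  apply: covering_minimumS_le => //; rewrite i0 /=.
  (* For [n = 0] the truncated [n - 1] is [0], which contradicts [1 <= i]. *)
  by case: n ni {hK hLam K Lam} => [|m]; rewrite ?subn1 // leqNgt i0.
split.
  (* The default value of the maximum is its own term [j = 1], hence bounded in the same way. *)
  rewrite big_nat_cond; apply: bigmax_le => [|j].
    by apply: packing_le_covering; rewrite ?i0.
  by rewrite andbT ltnS => ji; apply: packing_le_covering.
elim: i i0 ni => // -[_ _ n0|i IH _ ni].
  by rewrite big_nat1; apply: covering_minimum1_le.
rewrite big_nat_recr //=; apply: le_trans (lerD (IH _ (ltnW ni)) (lexx _)) => //.
exact: covering_minimumS_le.
Qed.
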